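(* Let $G$ be a countable group and let $A$ be a finite-dimensional vector space over a field $K$. Then the following conditions are equivalent: (a) every linear subshift $\Sigma \subset A^G$ is a subshift of finite type (SFT); (b) $A^G$ satisfies the descending chain condition for linear subshifts, that is, every decreasing sequence of linear subshifts of $A^G$ $$\Sigma_0 \supset \Sigma_1 \supset \cdots \supset \Sigma_n \supset \Sigma_{n+1} \supset \cdots$$ eventually stabilizes.
   Context: $A^G$ is the $K$-vector space of all maps $x \colon G \to A$, equipped with the prodiscrete topology (product topology with each factor $A$ discrete) and with the shift action of $G$ given by $(gx)(h) = x(g^{-1}h)$. A linear subshift of $A^G$ is a closed $G$-invariant vector subspace of $A^G$. A subset $\Sigma \subset A^G$ is a subshift of finite type (SFT) if there exist a finite subset $D \subset G$ and a subset $P \subset A^D$ such that $\Sigma = \{x \in A^G : (g^{-1}x)|_D \in P \text{ for all } g \in G\}$. A decreasing sequence $(\Sigma_n)_{n \in \mathbb{N}}$ eventually stabilizes if there exists $n_0$ such that $\Sigma_n = \Sigma_{n_0}$ for all $n \geq n_0$. *)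

(* Defs.v *)
From HB Require Import structures.
From mathcomp Require Import all_boot all_order all_algebra.
From mathcomp Require Import finmap.
From mathcomp Require Import all_classical topology.

Set Implicit Arguments.
Unset Strict Implicit.
Unset Printing Implicit Defensive.

Import GRing.Theory.
Local Open Scope classical_set_scope.

(* [G -> A] carries the pointwise [K]-module structure of [functions.v], but
   no canonical topology: the prodiscrete one is selected by [prodiscrete]. *)
Definition prodiscrete (G : Type) (A : choiceType) : topologicalType :=
  {ptws G -> discrete_topology A}.

Definition gshift (G : groupType) (A : Type) (g : G) (x : G -> A) : G -> A :=
  fun h => x (g^-1 * h)%g.

Definition restriction (G : choiceType) (A : Type) (D : {fset G})
    (x : G -> A) : D -> A :=
  fun d => x (val d).
Arguments restriction {G A} D x _.

Definition linear_subshift (G : groupType) (K : fieldType) (A : vectType K)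
    (Sigma : set (G -> A)) : Prop :=
  [/\ closed (Sigma : set (prodiscrete G A)),
      forall (g : G) (x : G -> A), Sigma x -> Sigma (gshift g x) &
      submod_closed (mem Sigma)].

Definition SFT (G : groupType) (A : Type) (Sigma : set (G -> A)) : Prop :=
  exists (D : {fset G}) (P : set (D -> A)),
    Sigma = [set x | forall g : G, P (restriction D (gshift g^-1%g x))].

Definition decreasing (T : Type) (Sigma : nat -> set T) : Prop :=
  forall n : nat, Sigma n.+1 `<=` Sigma n.

Definition eventually_stabilizes (T : Type) (Sigma : nat -> set T) : Prop :=
  exists n0 : nat, forall n : nat, (n0 <= n)%N -> Sigma n = Sigma n0.

(* Main.v *)
Require Import Defs.
From HB Require Import structures.
From mathcomp Require Import all_boot all_order all_algebra.
From mathcomp Require Import finmap.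
From mathcomp Require Import all_classical topology.

Set Implicit Arguments.
Unset Strict Implicit.
Unset Printing Implicit Defensive.

Local Open Scope classical_set_scope.

(** A closed subspace of [A^G] is determined by its restrictions to the finite
    subsets of an exhaustion of [G].  If [Sigma] is a linear subshift, the SFTs
    defined by these finite restrictions decrease to [Sigma], so the chain
    condition makes [Sigma] one of them.  Conversely, the restrictions to a
    fixed finite set of a decreasing sequence of linear subshifts are subspaces
    of a finite-dimensional space, hence stabilize; by a Mittag-Leffler
    argument along the exhaustion, every pattern of the stable restriction
    extends to an element of the intersection of the sequence.  If that
    intersection is an SFT with window [D], it therefore contains every term
    whose restriction to [D] is the stable one. *)

Import GRing.Theory.

(** * Descending chains of subspaces in finite dimension *)

Lemma submod_closed_setP (K : fieldType) (V : lmodType K) (S : set V) :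
  submod_closed (mem S) <->
  S 0%R /\ (forall (a : K) (u v : V), S u -> S v -> S (a *: u + v)%R).
Proof.
split=> [[S0 SD]|[S0 SD]]; split.
- by have := S0; rewrite inE.
- by move=> a u v Su Sv; have := SD a u v; rewrite !inE; apply.
- by rewrite inE.
- by move=> a u v; rewrite !inE; apply: SD.
Qed.

(** Among the subspaces contained in [S], take one of maximal dimension: adjoining any vector of [S]
    stays inside [S], so it cannot enlarge it. *)
Lemma submod_closed_vspace (K : fieldType) (W : vectType K) (S : set W) :
  submod_closed (mem S) -> exists U : {vspace W}, S = [set` U].
Proof.
move=> /submod_closed_setP[S0 SD].
pose P k := `[< exists2 U : {vspace W}, [set` U] `<=` S & \dim U = k >].
have exP : exists k, P k.
  exists 0%N; apply/asboolP; exists 0%VS; last exact: dimv0.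
  by move=> w /=; rewrite memv0 => /eqP ->.
have ubP k : P k -> (k <= \dim {:W})%N.
  by move=> /asboolP[U _ <-]; apply/dimvS/subvf.
have [k /asboolP[U US dimU] maxk] := ex_maxnP exP ubP.
exists U; apply/seteqP; split=> // w Sw /=.
have addS : [set` (U + <[w]>)%VS] `<=` S.
  move=> _ /= /memv_addP[u uU [_ /vlineP[a ->] ->]].
  by rewrite addrC; apply: SD => //; apply: US.
have le_dim : (\dim (U + <[w]>) <= \dim U)%N.
  by rewrite dimU; apply: maxk; apply/asboolP; exists (U + <[w]>)%VS.
have : (U == U + <[w]>)%VS by rewrite eqEdim addvSl.
by move=> /eqP ->; apply: (subvP (addvSr _ _)); apply: memv_line.
Qed.

Lemma nonincreasing_nat_stabilizes (d : nat -> nat) :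
  (forall m n, (m <= n)%N -> (d n <= d m)%N) ->
  exists N, forall n, (N <= n)%N -> d n = d N.
Proof.
move=> d_ni; have exP : exists k, `[< exists n, d n = k >].
  by exists (d 0%N); apply/asboolP; exists 0%N.
have [k /asboolP[N dN] mink] := ex_minnP exP.
exists N => n leNn; apply/eqP; rewrite eqn_leq d_ni //= dN.
by apply: mink; apply/asboolP; exists n.
Qed.

Lemma decreasing_subset (T : Type) (S : nat -> set T) :
  decreasing S -> forall m n, (m <= n)%N -> S n `<=` S m.
Proof.
move=> decS m n /subnK <-; elim: (n - m)%N => [//|k IHk].
by rewrite addSn; apply: subset_trans IHk; apply: decS.
Qed.

Lemma submod_chain_stabilizes (K : fieldType) (W : vectType K)
    (S : nat -> set W) :
  (forall n, submod_closed (mem (S n))) -> decreasing S ->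
  eventually_stabilizes S.
Proof.
move=> submodS decS.
have [U SU] := choice (fun n => submod_closed_vspace (submodS n)).
have leU m n : (m <= n)%N -> (U n <= U m)%VS.
  move=> lemn; apply/subvP => w Uw.
  by have := decreasing_subset decS lemn (t := w); rewrite !SU; apply.
have [N dN] := nonincreasing_nat_stabilizes (fun m n h => dimvS (leU m n h)).
exists N => n leNn; rewrite !SU.
suff -> : U n = U N by [].
by apply/eqP; rewrite eqEdim leU //= dN.
Qed.

Lemma sub_mkseq (T : eqType) (e : nat -> T) m n :
  (m <= n)%N -> {subset mkseq e m <= mkseq e n}.
Proof.
move=> lemn _ /mapP[i im ->]; apply: map_f; move: im; rewrite !mem_iota /=.
by rewrite !add0n => /leq_trans; apply.
Qed.

(** * The prodiscrete topology through finite windows *)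

Section Cylinders.
Variables (G : groupType) (A : choiceType).
Implicit Types (S : set (G -> A)) (x y : G -> A) (s : seq G).

Lemma nbhs_cylinder x s :
  nbhs (x : prodiscrete G A) [set y | {in s, x =1 y}].
Proof.
elim: s => [|g s IHs]; first by apply: filterS filterT => y _ ?.
have: nbhs (x : prodiscrete G A) [set y : G -> A | y g = x g].
  exact: (@proj_continuous G (fun=> discrete_topology A) g x [set x g]
            (discrete_set1 (x g : discrete_topology A))).
apply: filterS2 IHs => y xy yg h; rewrite inE => /predU1P[->|/xy] //.
Qed.

Lemma closed_prodiscrete S :
  (forall x, (forall s, exists2 y, S y & {in s, x =1 y}) -> S x) ->
  closed (S : set (prodiscrete G A)).
Proof.
move=> Sx x clx; apply: Sx => s.
by have [y [Sy xy]] := clx _ (nbhs_cylinder x s); exists y.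
Qed.

Lemma closed_exhaustion S x (e : nat -> G) (f : G -> nat) : cancel f e ->
  closed (S : set (prodiscrete G A)) ->
  (forall n, exists2 y, S y & {in mkseq e n, x =1 y}) -> S x.
Proof.
move=> fK clS approx.
have /choice[y Sxy] n : exists y, S y /\ {in mkseq e n, x =1 y}.
  by have [y] := approx n; exists y.
apply: (@closed_cvg _ (prodiscrete G A) \oo _ y S clS).
  by apply: filterE => n; have [] := Sxy n.
(* Convergence in the product is checked at one coordinate [g], where the approximants equal [x g]
   as soon as [n > f g]. *)
apply/cvg_sup => g U [_ [[W _ <-] /= Wx WU]].
exists (f g).+1 => // n /= fgn; apply: WU => /=.
have [_ xy] := Sxy n; rewrite -(xy g) //.
by apply/mapP; exists (f g); rewrite ?fK // mem_iota.
Qed.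
End Cylinders.

(** * Linear subshifts and their finite patterns *)

Section Subshifts.
Variables (G : groupType) (K : fieldType) (A : vectType K).
Implicit Types (S : set (G -> A)) (x y : G -> A) (s : seq G).

Lemma gshift1 x : gshift 1%g x = x.
Proof. by apply/funext => h; rewrite /gshift invg1 mul1g. Qed.

Lemma gshiftM (g h : G) x : gshift g (gshift h x) = gshift (g * h)%g x.
Proof. by apply/funext => k; rewrite /gshift invgM mulgA. Qed.

Lemma bigcap_linear_subshift (S : nat -> set (G -> A)) :
  (forall n, linear_subshift (S n)) -> linear_subshift (\bigcap_n S n).
Proof.
move=> linS; split.
- apply: (closed_bigI (T := prodiscrete G A)) => n _.
  by have [] := linS n.
- by move=> g x Sx n _; have [_ invS _] := linS n; apply/invS/Sx.
- apply/submod_closed_setP; split=> [n _|a u v Su Sv n _];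
    have [_ _ /submod_closed_setP[S0 SD]] := linS n => //.
  by apply: SD; [apply: Su | apply: Sv].
Qed.

(** Indexing by positions in [s] makes the patterns a finite-dimensional space; repetitions in [s]
    are harmless. *)
Definition pattern s x : {ffun 'I_(size s) -> A} :=
  [ffun i => x (tnth (in_tuple s) i)].

Lemma patternP s x y : pattern s x = pattern s y <-> {in s, x =1 y}.
Proof.
split=> [/ffunP xy g gs|xy].
  have /tnthP[i ->] : g \in in_tuple s by [].
  by have := xy i; rewrite !ffunE.
by apply/ffunP => i; rewrite !ffunE; apply/xy/(mem_tnth _ (in_tuple s)).
Qed.

Lemma submod_closed_pattern s S :
  submod_closed (mem S) -> submod_closed (mem (pattern s @` S)).
Proof.
move=> /submod_closed_setP[S0 SD]; apply/submod_closed_setP; split.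
  by exists 0%R => //; apply/ffunP => i; rewrite !ffunE.
move=> a _ _ [u Su <-] [v Sv <-]; exists (a *: u + v)%R; first exact: SD.
by apply/ffunP => i; rewrite !ffunE.
Qed.

(** The patterns on [s] form a decreasing chain of subspaces in finite dimension. The index [N]
    depends on [s]. *)
Lemma patterns_stabilize s (S : nat -> set (G -> A)) :
  (forall n, linear_subshift (S n)) -> decreasing S ->
  exists N, forall x, S N x -> forall m, exists2 y, S m y & {in s, x =1 y}.
Proof.
move=> linS decS; have [||N stab] :=
    @submod_chain_stabilizes K _ (fun n => pattern s @` S n).
- by move=> n; have [_ _] := linS n; apply: submod_closed_pattern.
- by move=> n _ [x Sx <-]; exists x => //; apply: decS.
exists N => x SNx m; have [leNm|/ltnW lemN] := leqP N m; last first.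
  by exists x => //; apply: decreasing_subset lemN _ SNx.
have : (pattern s @` S m) (pattern s x) by rewrite stab //; exists x.
by move=> [y Sy /patternP yx]; exists y => // g gs; rewrite yx.
Qed.

(* Mittag-Leffler: the patterns on [mkseq e n] common to all [S m] lift from
   [n] to [n + 1], and the limit of a coherent sequence of lifts lies in every
   [S m] because [S m] is closed. *)
Lemma bigcap_pattern (e : nat -> G) (f : G -> nat) (S : nat -> set (G -> A))
    k x : cancel f e ->
  (forall n, linear_subshift (S n)) -> decreasing S ->
  (forall m, exists2 y, S m y & {in mkseq e k, x =1 y}) ->
  exists2 y, (\bigcap_n S n) y & {in mkseq e k, x =1 y}.
Proof.
move=> fK linS decS Wx.
pose W n x := forall m, exists2 y, S m y & {in mkseq e n, x =1 y}.
have lift n z : exists z', W n z -> W n.+1 z' /\ {in mkseq e n, z =1 z'}.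
  (* The lift has to be total for [choice]; [z] is a default when it has nothing to lift. *)
  have [Wz|nWz] := pselect (W n z); last by exists z.
  have [N stab] := patterns_stabilize (mkseq e n.+1) linS decS.
  by have [z' SNz' zz'] := Wz N; exists z' => _; split=> // m; apply: stab.
have /choice[F FP] (p : nat * (G -> A)) := lift p.1 p.2.
pose X := fix X j := if j is i.+1 then F ((k + i)%N, X i) else x.
have WX j : W (k + j)%N (X j).
  by elim: j => [|j IHj]; rewrite ?addn0 ?addnS //=; have [] := FP (_, _) IHj.
have coh i j : (i <= j)%N -> {in mkseq e (k + i), X i =1 X j}.
  move=> /subnK <-; elim: (j - i)%N => [//|d IHd] g gi.
  rewrite IHd // addSn /=; have [_] := FP (_, _) (WX (d + i)%N); apply.
  by apply: sub_mkseq gi; rewrite leq_add2l leq_addl.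
(* By stage [(f g).+1] the window contains [g], and coherence freezes the value at [g] from then
   on. *)
pose y g := X (f g).+1 g.
have Xy j : {in mkseq e (k + j), X j =1 y}.
  move=> g gj; rewrite /y; have [lej|/ltnW lej] := leqP j (f g).+1.
    exact: coh lej _ gj.
  apply/esym/(coh _ _ lej)/mapP; exists (f g); last by rewrite fK.
  by rewrite mem_iota add0n addnS ltnS leq_addl.
exists y; last by move=> g gk; apply: (Xy 0%N); rewrite addn0.
move=> m _; have [clS _ _] := linS m; apply: (closed_exhaustion fK clS) => n.
have [z Sz Xz] := WX n m; exists z => // g gn.
have gkn : g \in mkseq e (k + n) by apply: sub_mkseq gn; rewrite leq_addl.
by rewrite -(Xy n) // Xz.
Qed.

(** For a subshift [S], this is the least SFT with window [s] that contains [S]. *)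
Definition pattern_closure s S : set (G -> A) :=
  [set x | forall g, exists2 y, S y & {in s, gshift g^-1%g x =1 y}].

Lemma pattern_closure_SFT s S : SFT (pattern_closure s S).
Proof.
exists [fset g in s]%fset, [set p | exists2 y, S y & forall d, p d = y (val d)].
apply/seteqP; split=> x Px g; have [y Sy xy] := Px g; exists y => //.
  by move=> d; apply: xy; have := valP d; rewrite inE.
move=> h hs; have hD : h \in [fset g in s]%fset by rewrite inE.
exact: (xy [` hD]%fset).
Qed.

Lemma sub_pattern_closure s S :
  linear_subshift S -> S `<=` pattern_closure s S.
Proof.
by move=> [_ invS _] x Sx g; exists (gshift g^-1%g x) => //; apply: invS.
Qed.

Lemma pattern_closure_linear s S :
  linear_subshift S -> linear_subshift (pattern_closure s S).
Proof.
move=> [_ invS /submod_closed_setP[S0 SD]]; split.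
- apply: closed_prodiscrete => x approx g.
  (* The condition at [g] only reads the coordinates [g * h] with [h] in [s]. *)
  have [y Py xy] := approx [seq (g * h)%g | h <- s].
  have [z Sz yz] := Py g; exists z => // h hs.
  by rewrite -yz // /gshift invgK xy // map_f.
- move=> g x Px h; have := Px (g^-1 * h)%g.
  by rewrite gshiftM invgM invgK.
- apply/submod_closed_setP; split=> [g|a u v Pu Pv g]; first by exists 0%R.
  have [u' Su' uu'] := Pu g; have [v' Sv' vv'] := Pv g.
  exists (a *: u' + v')%R; first exact: SD.
  move=> h hs; have := uu' h hs; have := vv' h hs.
  by rewrite /gshift /= => vh uh; rewrite !fctE vh uh.
Qed.

Lemma pattern_closureS s t S :
  {subset s <= t} -> pattern_closure t S `<=` pattern_closure s S.
Proof.
move=> st x Px g; have [y Sy xy] := Px g; exists y => // h /st; exact: xy.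
Qed.

(** The conditions at the identity alone say that [x] is approximated by [S] on every window;
    closedness does the rest. *)
Lemma bigcap_pattern_closure (e : nat -> G) (f : G -> nat) S :
  cancel f e -> linear_subshift S ->
  \bigcap_n pattern_closure (mkseq e n) S `<=` S.
Proof.
move=> fK [clS _ _] x Px; apply: (closed_exhaustion fK clS) => n.
by have := Px n I 1%g; rewrite invg1 gshift1.
Qed.

End Subshifts.

Lemma countable_cancel (T : Type) (t0 : T) : countable [set: T] ->
  exists (e : nat -> T) (f : T -> nat), cancel f e.
Proof.
move=> /countable_injP[f f_inj].
(* Outside the range of [f], [e] may take the default [t0], so finite types are covered as well. *)
have /choice[e eP] n : exists t, (exists t', f t' = n) -> f t = n.
  have [[t ft]|nt] := pselect (exists t', f t' = n); first by exists t.
  by exists t0 => /nt.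
exists e, f => t; apply: f_inj; rewrite ?inE //.
by apply: eP; exists t.
Qed.

Theorem corollary1p2 (G : groupType) (countG : countable [set: G])
    (K : fieldType) (A : vectType K) :
  (forall Sigma : set (G -> A), linear_subshift Sigma -> SFT Sigma)
  <->
  (forall Sigma : nat -> set (G -> A),
     (forall n : nat, linear_subshift (Sigma n)) ->
     decreasing Sigma -> eventually_stabilizes Sigma).
Proof.
have [e [f fK]] := countable_cancel (1%g : G) countG.
split=> [sft S linS decS|dcc S linS].
  have [D [P capE]] := sft _ (bigcap_linear_subshift linS).
  (* The first [k] terms of the exhaustion contain the window [D]. *)
  pose k := (\max_(g <- D) f g).+1.
  have Dk g : g \in D -> g \in mkseq e k.
    move=> gD; apply/mapP; exists (f g); last by rewrite fK.
    by rewrite mem_iota add0n ltnS; apply: leq_bigmax_seq.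
  have [N stab] := patterns_stabilize (mkseq e k) linS decS.
  have SN : S N `<=` \bigcap_n S n.
    move=> x SNx; rewrite capE => g.
    have [_ invS _] := linS N.
    (* The translate of [x] stays in [S N], so its pattern is common to all terms and extends to
       some [y] in the intersection; hence its restriction to [D] is allowed. *)
    have /(bigcap_pattern fK linS decS)[y Sy xy] :=
      stab _ (invS g^-1%g _ SNx).
    have -> : restriction D (gshift g^-1%g x) = restriction D y.
      by apply/funext => d; apply/xy/Dk/valP.
    by move: Sy; rewrite capE => /(_ 1%g); rewrite invg1 gshift1.
  exists N => n leNn; apply/seteqP; split; first exact: decreasing_subset.
  by move=> x /SN; apply.
have [||N stab] := dcc (fun n => pattern_closure (mkseq e n) S).
- by move=> n; apply: pattern_closure_linear.
- by move=> n; apply/pattern_closureS/sub_mkseq.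
suff -> : S = pattern_closure (mkseq e N) S by apply: pattern_closure_SFT.
apply/seteqP; split; first exact: sub_pattern_closure.
(* The stable closure lies in all the others: later ones equal it and earlier ones contain it. *)
move=> x Px; apply: (bigcap_pattern_closure fK linS) => n _.
have [leNn|/ltnW lenN] := leqP N n; first by rewrite stab.
exact: pattern_closureS (sub_mkseq lenN) _ Px.
Qed.
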